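(* Consider the joint association and relaying problem (P) described in the context, and suppose the binary association variables $\mathbf x$ are fixed and feasible. For each $k\in\mathcal A$ let $$n_k=\sum_{i\in\mathcal C}x_{ik}+\sum_{i\in\mathcal C_-}\sum_{j\in\mathcal C_+}x_{ij}x_{jk}$$ be the number of clients and relays associated with AP $k$ (directly or via a relay). Then the optimal resource allocation $\mathbf y^*$ for problem (P) with association $\mathbf x$ is: (a) $y_{ik}^*=1/n_k$ if $x_{ik}=1$, for all $i\in\mathcal C_-$, $k\in\mathcal A$; (b) $y_{jk}^*=1/n_k$ if $\sum_{i\in\mathcal C_-}x_{ij}=0$ and $x_{jk}=1$, for all $j\in\mathcal C_+$, $k\in\mathcal A$; (c) $y_{ik}^*=y_{jk}^*=2/n_k$ if $x_{ij}x_{jk}=1$, for all $i\in\mathcal C_-$, $j\in\mathcal C_+$, $k\in\mathcal A$.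
   Context: $\mathcal A$ is a finite set of access points (APs), $\mathcal C$ a finite set of clients, $\mathcal C_+\subseteq\mathcal C$ the subset of relays (clients with relaying capability), and $\mathcal C_-=\mathcal C\setminus\mathcal C_+$. For each link $(a,b)$ (client–relay $(i,j)$, client–AP $(i,k)$, relay–AP $(j,k)$) the achievable rate is a random variable $c_{ab}=\log_2(1+\mathrm{SNR}_{ab})$, whose conditional distribution given an estimate $\widetilde{\mathrm{SNR}}_{ab}$ is known. Fix a design parameter $\eta\in(0,1)$. For each link there is a (unique) threshold $\hat c^{\eta}_{ab}$ with $\Pr(c_{ab}\le \hat c^{\eta}_{ab}\mid \widetilde{\mathrm{SNR}}_{ab})=\eta$. Problem (P): the variables are $\mathbf x=(x_{ij},x_{ik},x_{jk})$ (association indicators), $\mathbf r=(r_i)_{i\in\mathcal C}$ (real rates), $\mathbf y=(y_{ik})_{i\in\mathcal C,k\in\mathcal A}$ (resource fractions). Maximize $$\sum_{i\in\mathcal C}\sum_{k\in\mathcal A}x_{ik}\log(r_iy_{ik})+\sum_{i\in\mathcal C_-}\sum_{j\in\mathcal C_+}\sum_{k\in\mathcal A}x_{ij}x_{jk}\log(r_iy_{ik})$$ (a term with coefficient $0$ counts as $0$; a term with nonzero coefficient requires $r_iy_{ik}>0$) subject to, for all $i\in\mathcal C_-$, $j\in\mathcal C_+$, $k\in\mathcal A$: - $\Pr(r_ix_{ij}\ge c_{ij}\mid\widetilde{\mathrm{SNR}}_{ij})\le\eta$ and $\Pr(r_ix_{ik}\ge c_{ik}\mid\widetilde{\mathrm{SNR}}_{ik})\le\eta$;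 - $\Pr\left(\left(\sum_{i\in\mathcal C_-}r_ix_{ij}+r_j\right)x_{jk}\ge c_{jk}\,\middle|\,\widetilde{\mathrm{SNR}}_{jk}\right)\le\eta$; - $\sum_{j\in\mathcal C_+}x_{ij}+\sum_{k\in\mathcal A}x_{ik}=1$; - $\sum_{i\in\mathcal C_-}x_{ij}\le1$ and $\sum_{k\in\mathcal A}x_{jk}=1$; - $(y_{ik}-y_{jk})x_{ij}=0$; - $x_{ij},x_{ik},x_{jk}\in\{0,1\}$; - $\sum_{i\in\mathcal C}x_{ik}y_{ik}\le1$ for all $k\in\mathcal A$, and $y_{ik}\ge0$ for all $i\in\mathcal C$, $k\in\mathcal A$. ''$\mathbf x$ fixed and feasible'' means that $\mathbf x$ is held fixed and there exist $\mathbf r,\mathbf y$ such that all constraints hold and the objective is well defined; the optimization is then over $\mathbf r,\mathbf y$ only. Only the entries of $\mathbf y$ appearing with nonzero coefficient in the objective (those listed in (a)–(c)) are determined. *)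

(* Defs.v *)
From HB Require Import structures.
From mathcomp Require Import all_boot all_order all_algebra.
From mathcomp Require Import all_classical all_reals all_analysis.

Set Implicit Arguments.
Unset Strict Implicit.
Unset Printing Implicit Defensive.
Import Order.TTheory GRing.Theory Num.Theory.
Import numFieldNormedType.Exports.

Local Open Scope classical_set_scope.
Local Open Scope ring_scope.

(* The achievable rate log_2 (1 + SNR), as a function on the sample space. *)
Definition rate (R : realType) (T : Type) (snr : T -> R) : T -> R :=
  fun w => ln (1 + snr w) / ln 2.

(* [K] is a regular version of the conditional distribution of [c] given [S]:
   K s B is Pr(c \in B | S = s). *)
Definition is_cond_distribution (d : measure_display) (T : measurableType d)
    (R : realType) (P : probability T R) (S : {RV P >-> R}) (c : T -> R)
    (K : R.-pker R ~> R) : Prop :=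
  forall U B : set R, measurable U -> measurable B ->
    P (S @^-1` U `&` c @^-1` B) = (\int[distribution P S]_(s in U) K s B)%E.

Section Association.
Variables (R : realType) (A C : finType) (Cp : {set C}).

(* A link goes from a client to a node of type [C + A]: [inl j] is the client
   j, which must be a relay, and [inr k] is the access point k.  All families
   indexed by client and node are used on links only; their other values are
   irrelevant. *)
Definition is_link (i : C) (b : C + A) : bool :=
  match b with
  | inl j => (i \notin Cp) && (j \in Cp)
  | inr _ => true
  end.

Variables (law : C -> C + A -> R.-pker R ~> R) (s : C -> C + A -> R).

(* Pr(c_ib \in B | estimate of SNR_ib), at the observed estimate s i b. *)
Definition condPr (i : C) (b : C + A) (B : set R) : \bar R :=
  law i b (s i b) B.

Variables (eta : R) (x : C -> C + A -> R).

Record constraints (r : C -> R) (y : C -> A -> R) : Prop := Constraints {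
  outage_client_relay : forall i j, i \notin Cp -> j \in Cp ->
    (condPr i (inl j) [set c | r i * x i (inl j) >= c]%R <= eta%:E)%E;
  outage_client_ap : forall i k, i \notin Cp ->
    (condPr i (inr k) [set c | r i * x i (inr k) >= c]%R <= eta%:E)%E;
  outage_relay_ap : forall j k, j \in Cp ->
    (condPr j (inr k)
       [set c | ((\sum_(i | i \notin Cp) r i * x i (inl j)) + r j)
                * x j (inr k) >= c]%R <= eta%:E)%E;
  client_assoc : forall i, i \notin Cp ->
    \sum_(j in Cp) x i (inl j) + \sum_(k : A) x i (inr k) = 1;
  relay_load : forall j, j \in Cp -> \sum_(i | i \notin Cp) x i (inl j) <= 1;
  relay_assoc : forall j, j \in Cp -> \sum_(k : A) x j (inr k) = 1;
  relay_share : forall i j k, i \notin Cp -> j \in Cp ->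
    (y i k - y j k) * x i (inl j) = 0;
  assoc_binary : forall i b, is_link i b -> x i b = 0 \/ x i b = 1;
  ap_budget : forall k, \sum_(i : C) x i (inr k) * y i k <= 1;
  fraction_ge0 : forall i k, 0 <= y i k
}.

Definition objective (r : C -> R) (y : C -> A -> R) : R :=
  \sum_(i : C) \sum_(k : A) x i (inr k) * ln (r i * y i k)
  + \sum_(i | i \notin Cp) \sum_(j in Cp) \sum_(k : A)
      x i (inl j) * x j (inr k) * ln (r i * y i k).

(* [ln] is totalized by 0 on nonpositive reals, so positivity of the arguments
   that occur with a nonzero coefficient has to be required separately. *)
Definition objective_defined (r : C -> R) (y : C -> A -> R) : Prop :=
  (forall i k, x i (inr k) != 0 -> 0 < r i * y i k) /\
  (forall i j k, i \notin Cp -> j \in Cp ->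
     x i (inl j) * x j (inr k) != 0 -> 0 < r i * y i k).

Definition feasible (r : C -> R) (y : C -> A -> R) : Prop :=
  constraints r y /\ objective_defined r y.

Definition optimal (r : C -> R) (y : C -> A -> R) : Prop :=
  feasible r y /\
  forall r' y', feasible r' y' -> objective r' y' <= objective r y.

Definition ap_load (k : A) : R :=
  \sum_(i : C) x i (inr k)
  + \sum_(i | i \notin Cp) \sum_(j in Cp) x i (inl j) * x j (inr k).

End Association.

(* Main.v *)
(** Each logarithm splits as ln r_i + ln y_ik, and no constraint couples r and y,
so the two blocks are optimized separately.

Fractions: at AP k one maximizes a weighted sum of w_i ln y_ik over the clients
and relays attached directly to k, under the budget that the y_ik add up to at
most 1. The weight w_i is 2 for a relay with a client and 1 otherwise, and the
weights at k add up to n_k. The inequality ln u <= u - 1, applied to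
u = y_ik n_k / w_i, gives y_ik = w_i / n_k, and its equality case u = 1 gives
uniqueness.

Rates: monotonicity of Pr(c <= z) in z and uniqueness of the thresholds turn
the outage constraints into linear bounds on r. A maximizer is then explicit: a
client served directly or a relay without client saturates its link, and a
relay j with client i takes r_i = min(t_ij, t_jk / 2) and r_j = t_jk - r_i. *)

Require Import Defs.
From HB Require Import structures.
From mathcomp Require Import all_boot all_order all_algebra.
From mathcomp Require Import all_classical all_reals all_analysis.
From mathcomp Require Import ring lra.

Set Implicit Arguments.
Unset Strict Implicit.
Unset Printing Implicit Defensive.
Import Order.TTheory GRing.Theory Num.Theory.
Import numFieldNormedType.Exports.

Local Open Scope classical_set_scope.
Local Open Scope ring_scope.

(** * Elementary inequalities and outage thresholds *)

Lemma psumr_le0_eq0 (R : realType) (I : finType) (p : pred I) (f : I -> R) :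
  (forall i, p i -> 0 <= f i) -> \sum_(i | p i) f i <= 0 ->
  forall i, p i -> f i = 0.
Proof.
move=> f0 s0; apply: psumr_eq0P => //.
by apply/eqP; rewrite eq_le s0 sumr_ge0.
Qed.

(** Once the entry 1 is removed, what remains is nonnegative with total at most 0, so every other
    entry vanishes. Each uniqueness of an association (one AP, one relay, one client) is used in
    this form. *)
Lemma sum_indicator_pick (R : realType) (I : finType) (p : pred I)
    (z f : I -> R) (i0 : I) :
  (forall i, p i -> z i = 0 \/ z i = 1) -> \sum_(i | p i) z i <= 1 ->
  p i0 -> z i0 = 1 -> \sum_(i | p i) z i * f i = f i0.
Proof.
move=> z01 zs pi0 zi0.
move: zs; rewrite (bigD1 i0) //= [in X in _ -> X](bigD1 i0) //= zi0 mul1r => zs.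
rewrite big1 ?addr0 // => i pi.
suff -> : z i = 0 by rewrite mul0r.
apply: (@psumr_le0_eq0 R I (fun i => p i && (i != i0)) z) pi.
  by move=> j /andP[pj _]; case: (z01 _ pj) => ->.
lra.
Qed.

Lemma ln_gap_ge0 (R : realType) (u : R) : 0 < u -> 0 <= u - 1 - ln u.
Proof. by move=> u0; have := expR_ge1Dx (ln u); rewrite lnK //; lra. Qed.

(** The bound [1 + v <= expR v] at [v = ln u] is strict unless [v = 0]; this is the source of
    uniqueness of the fractions. *)
Lemma ln_gap_eq0 (R : realType) (u : R) : 0 < u -> u - 1 - ln u = 0 -> u = 1.
Proof.
move=> u0 gap0; have [lnu0|lnu0] := eqVneq (ln u) 0; first by move: gap0; lra.
by have := expR_gt1Dx lnu0; rewrite lnK //; lra.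
Qed.

(** With the relay taking all the remaining capacity, the product [a * (T - a)] increases up to
    [a = T / 2], so the best [a] is the point of the allowed range nearest to [T / 2]. *)
Lemma ln_two_hop_le (R : realType) (t T a b : R) :
  0 < a -> 0 < b -> a <= t -> a + b <= T ->
  ln a + ln b <= ln (Num.min t (T / 2)) + ln (T - Num.min t (T / 2)).
Proof.
move=> a0 b0 at_ abT.
have m0 : 0 < Num.min t (T / 2) by rewrite lt_min; apply/andP; split; lra.
have mT : Num.min t (T / 2) <= T / 2 by rewrite ge_min lexx orbT.
have Tm0 : 0 < T - Num.min t (T / 2) by lra.
rewrite -!lnM ?posrE // ler_ln ?posrE ?mulr_gt0 //.
have ab : a * b <= a * (T - a) by rewrite ler_pM2l //; lra.
apply: le_trans ab _.
(* If [t] binds, the difference of the products factors as [(t - a) * (T - t - a)]; otherwise it is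
   a square. *)
case: (leP t (T / 2)) => tT.
  rewrite -subr_ge0 (_ : _ - _ = (t - a) * (T - t - a)); last by ring.
  by rewrite mulr_ge0 //; lra.
rewrite -subr_ge0 (_ : _ - _ = (a - T / 2) ^+ 2); last by field.
exact: sqr_ge0.
Qed.

(** If some [z] beyond the threshold still had outage at most [eta], monotonicity would make its
    outage equal to [eta], giving a second threshold. *)
Lemma outage_threshold (R : realType) (A C : finType)
    (law : C -> C + A -> R.-pker R ~> R) (s : C -> C + A -> R) (eta : R)
    (i : C) (b : C + A) :
  (exists! t : R, condPr law s i b [set c | c <= t] = eta%:E) ->
  exists t : R, forall z : R,
    (condPr law s i b [set c | z >= c]%R <= eta%:E)%E <-> z <= t.
Proof.
move=> [t [ht tuniq]]; exists t => z.
have mono u v : u <= v ->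
    (condPr law s i b [set c | (c <= u)%R] <=
     condPr law s i b [set c | (c <= v)%R])%E.
  move=> uv; rewrite /condPr; apply: le_measure.
  - by rewrite inE -set_itvNyc; exact: measurable_itv.
  - by rewrite inE -set_itvNyc; exact: measurable_itv.
  - by move=> c /= cu; exact: le_trans cu uv.
split=> [hz|zt]; last by rewrite -ht; exact: mono.
rewrite leNgt; apply/negP => tz.
have tz' : t = z.
  by apply: tuniq; apply/eqP; rewrite eq_le hz -ht mono // ltW.
by move: tz; rewrite tz' ltxx.
Qed.

(** * Structure of a fixed binary association *)

Section Association.
Variables (R : realType) (A C : finType) (Cp : {set C}).
Variable x : C -> C + A -> R.

(* The part of a sum over the terms of the objective that concerns AP [k]. *)
Definition served (k : A) (f : C -> R) : R :=
  \sum_(i : C) x i (inr k) * f i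
  + \sum_(i | i \notin Cp) \sum_(j in Cp) x i (inl j) * x j (inr k) * f i.

Definition uses (i : C) (k : A) : Prop :=
  x i (inr k) = 1 \/
  exists j, [/\ i \notin Cp, j \in Cp, x i (inl j) = 1 & x j (inr k) = 1].

(* The number of logarithms in the objective that contain the fraction of [i]:
   a relay and its client must have equal fractions, so theirs counts twice. *)
Definition weight (i : C) : R :=
  1 + (if i \in Cp then \sum_(i' | i' \notin Cp) x i' (inl i)
       else \sum_(j in Cp) x i (inl j)).

Definition fair (i : C) (k : A) : R := weight i / ap_load Cp x k.

Lemma ap_loadE k : ap_load Cp x k = served k (fun=> 1).
Proof.
rewrite /ap_load /served; congr (_ + _).
  by apply: eq_bigr => i _; rewrite mulr1.
by apply: eq_bigr => i _; apply: eq_bigr => j _; rewrite mulr1.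
Qed.

Lemma objectiveE r y :
  objective Cp x r y = \sum_k served k (fun i => ln (r i * y i k)).
Proof.
rewrite /objective /served big_split /=; congr (_ + _); first exact: exchange_big.
rewrite [RHS]exchange_big /=; apply: eq_bigr => i _; exact: exchange_big.
Qed.

Lemma servedB k f g : served k (fun i => f i - g i) = served k f - served k g.
Proof.
rewrite /served opprD addrACA -!sumrB; congr (_ + _).
  by apply: eq_bigr => i _; rewrite mulrBr.
apply: eq_bigr => i _; rewrite -sumrB.
by apply: eq_bigr => j _; rewrite mulrBr.
Qed.

(** Every relayed term is moved next to the term of its relay, so that a relay and its client can be
    treated as one unit. *)
Lemma served_by_transmitter k f : served k f =
  \sum_(i | i \notin Cp) x i (inr k) * f i
  + \sum_(j in Cp) x j (inr k) * (f j + \sum_(i | i \notin Cp) x i (inl j) * f i).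
Proof.
rewrite /served (bigID (fun i => i \in Cp)) /= [X in X + _]addrC -addrA.
congr (_ + _); rewrite exchange_big /= -big_split /=.
apply: eq_bigr => j _; rewrite mulrDr mulr_sumr; congr (_ + _).
by apply: eq_bigr => i _; ring.
Qed.

Hypothesis x01 : forall i b, is_link Cp i b -> x i b = 0 \/ x i b = 1.
Hypothesis client1 : forall i, i \notin Cp ->
  \sum_(j in Cp) x i (inl j) + \sum_(k : A) x i (inr k) = 1.
Hypothesis load1 : forall j, j \in Cp -> \sum_(i | i \notin Cp) x i (inl j) <= 1.
Hypothesis relay1 : forall j, j \in Cp -> \sum_(k : A) x j (inr k) = 1.

Lemma ap01 i k : x i (inr k) = 0 \/ x i (inr k) = 1.
Proof. exact: x01. Qed.

Lemma relay01 i j : i \notin Cp -> j \in Cp -> x i (inl j) = 0 \/ x i (inl j) = 1.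
Proof. by move=> iC jC; apply: x01; rewrite /= iC jC. Qed.

Lemma link_ge0 i b : is_link Cp i b -> 0 <= x i b.
Proof. by move/x01 => [] ->. Qed.

Lemma relay_ge0 i j : i \notin Cp -> j \in Cp -> 0 <= x i (inl j).
Proof. by move=> iC jC; apply: link_ge0; rewrite /= iC jC. Qed.

Lemma sum_relay_ge0 i : i \notin Cp -> 0 <= \sum_(j in Cp) x i (inl j).
Proof. by move=> iC; apply: sumr_ge0 => j jC; exact: relay_ge0. Qed.

Lemma sum_ap_ge0 i : 0 <= \sum_(k : A) x i (inr k).
Proof. by apply: sumr_ge0 => k _; exact: link_ge0. Qed.

Lemma client_ap_pick i k f : i \notin Cp -> x i (inr k) = 1 ->
  \sum_(k' : A) x i (inr k') * f k' = f k.
Proof.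
move=> iC xik; apply: sum_indicator_pick => // [k' _|]; first exact: ap01.
by have := client1 iC; have := sum_relay_ge0 iC; lra.
Qed.

Lemma relay_ap_pick j k f : j \in Cp -> x j (inr k) = 1 ->
  \sum_(k' : A) x j (inr k') * f k' = f k.
Proof.
move=> jC xjk; apply: sum_indicator_pick => // [k' _|]; first exact: ap01.
by rewrite relay1.
Qed.

Lemma client_relay_pick i j f : i \notin Cp -> j \in Cp -> x i (inl j) = 1 ->
  \sum_(j' in Cp) x i (inl j') * f j' = f j.
Proof.
move=> iC jC xij; apply: sum_indicator_pick => // [j' jC'|]; first exact: relay01.
by have := client1 iC; have := sum_ap_ge0 i; lra.
Qed.

Lemma relay_client_pick i j f : i \notin Cp -> j \in Cp -> x i (inl j) = 1 ->
  \sum_(i' | i' \notin Cp) x i' (inl j) * f i' = f i.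
Proof.
move=> iC jC xij.
apply: (@sum_indicator_pick _ _ _ (fun i => x i (inl j))) => //; last exact: load1.
by move=> i' iC'; exact: relay01.
Qed.

Lemma direct_no_relay i k j : i \notin Cp -> x i (inr k) = 1 -> j \in Cp ->
  x i (inl j) = 0.
Proof.
move=> iC xik; move: j.
apply: (@psumr_le0_eq0 _ _ (fun j => j \in Cp) (fun j => x i (inl j))).
  by move=> j jC; exact: relay_ge0.
have := client_ap_pick (fun=> 1) iC xik.
rewrite -mulr_suml mulr1 => xi1.
by have := client1 iC; lra.
Qed.

Lemma relayed_no_ap i j k : i \notin Cp -> j \in Cp -> x i (inl j) = 1 ->
  x i (inr k) = 0.
Proof. by move=> iC jC xij; case: (ap01 i k) => // /direct_no_relay - /(_ _ iC jC); lra. Qed.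

Variant relay_spec (j : C) : Prop :=
| RelayIdle of forall i, i \notin Cp -> x i (inl j) = 0
| RelayBusy i of i \notin Cp & x i (inl j) = 1.

Lemma relayP j : j \in Cp -> relay_spec j.
Proof.
move=> jC; have [[i [iC xij]]|nobody] :=
  pselect (exists i, i \notin Cp /\ x i (inl j) = 1); first exact: RelayBusy xij.
apply: RelayIdle => i iC; case: (relay01 iC jC) => // xij.
by case: nobody; exists i.
Qed.

(** Outside [uses] the coefficients are 0, so identities for [ln] are needed only where the
    arguments are known to be positive. *)
Lemma eq_served k f g : (forall i, uses i k -> f i = g i) ->
  served k f = served k g.
Proof.
move=> fg; congr (_ + _).
  apply: eq_bigr => i _; case: (ap01 i k) => [->|xik]; first by rewrite !mul0r.
  by rewrite fg //; left.
apply: eq_bigr => i iC; apply: eq_bigr => j jC.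
case: (relay01 iC jC) => [->|xij]; first by rewrite !mul0r.
case: (ap01 j k) => [->|xjk]; first by rewrite mulr0 !mul0r.
by rewrite fg //; right; exists j.
Qed.

Lemma served_terms_ge0 k (f : C -> R) : (forall i, uses i k -> 0 <= f i) ->
  (forall i, 0 <= x i (inr k) * f i) /\
  (forall i j, i \notin Cp -> j \in Cp ->
     0 <= x i (inl j) * x j (inr k) * f i).
Proof.
move=> f0; split=> [i|i j iC jC].
  case: (ap01 i k) => [->|xik]; first by rewrite mul0r.
  by rewrite xik mul1r; apply: f0; left.
case: (relay01 iC jC) => [->|xij]; first by rewrite !mul0r.
case: (ap01 j k) => [->|xjk]; first by rewrite mulr0 !mul0r.
by rewrite xij xjk !mul1r; apply: f0; right; exists j.
Qed.

Lemma served_ge0 k (f : C -> R) : (forall i, uses i k -> 0 <= f i) -> 0 <= served k f.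
Proof.
move=> /served_terms_ge0[d0 r0]; apply: addr_ge0; apply: sumr_ge0 => // i iC.
by apply: sumr_ge0 => j jC; exact: r0.
Qed.

Lemma served_le0_eq0 k (f : C -> R) : (forall i, uses i k -> 0 <= f i) ->
  served k f <= 0 -> forall i, uses i k -> f i = 0.
Proof.
move=> /served_terms_ge0[d0 r0] s0.
have r0' i : i \notin Cp ->
    0 <= \sum_(j in Cp) x i (inl j) * x j (inr k) * f i.
  by move=> iC; apply: sumr_ge0 => j jC; exact: r0.
have D0 : 0 <= \sum_i x i (inr k) * f i by exact: sumr_ge0.
have R0 := sumr_ge0 (index_enum C) r0'.
move: s0; rewrite /served /= => s0 i [xik|[j [iC jC xij xjk]]].
  rewrite -[f i]mul1r -xik.
  by apply: (@psumr_le0_eq0 R C predT (fun i => x i (inr k) * f i)) => //=; lra.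
(* The relayed double sum vanishes in two stages: first the inner sum of client [i], then its term
   for relay [j]. *)
rewrite -[f i]mul1r -[X in X * _](mulr1 1) -{1}xij -xjk.
apply: (@psumr_le0_eq0 R C (fun j => j \in Cp)
  (fun j => x i (inl j) * x j (inr k) * f i)) => // [j' jC'|]; first exact: r0.
rewrite (psumr_le0_eq0 r0') //.
by move: s0 D0; set a := \sum_i _; set b := \sum_(i | _) _; lra.
Qed.

(** * Weights and fair fractions *)

Lemma weight_direct i k : i \notin Cp -> x i (inr k) = 1 -> weight i = 1.
Proof.
move=> iC xik; rewrite /weight (negbTE iC) big1 ?addr0 // => j jC.
exact: direct_no_relay xik jC.
Qed.

Lemma weight_relayed i j : i \notin Cp -> j \in Cp -> x i (inl j) = 1 ->
  weight i = 2.
Proof.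
move=> iC jC xij; rewrite /weight (negbTE iC).
by rewrite -[\sum_(_ in _) _]mulr1 mulr_suml (client_relay_pick (fun=> 1) iC jC).
Qed.

Lemma weight_relay i j : i \notin Cp -> j \in Cp -> x i (inl j) = 1 ->
  weight j = 2.
Proof.
move=> iC jC xij; rewrite /weight jC.
by rewrite -[\sum_(_ | _) _]mulr1 mulr_suml (relay_client_pick (fun=> 1) iC jC).
Qed.

Lemma weight_gt0 i : 0 < weight i.
Proof.
rewrite /weight; apply: ltr_pwDl => //; case: ifPn => iC; last exact: sum_relay_ge0.
by apply: sumr_ge0 => i' iC'; exact: relay_ge0.
Qed.

(** A client's value merges into that of its relay, leaving a weighted sum over the nodes attached
    directly to [k], which are exactly those charged in the budget. *)
Lemma served_share k f :
  (forall i j, i \notin Cp -> j \in Cp -> x i (inl j) = 1 -> f i = f j) ->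
  served k f = \sum_i x i (inr k) * (weight i * f i).
Proof.
move=> fs; rewrite served_by_transmitter addrC.
rewrite [RHS](bigID (fun i => i \in Cp)) /=; congr (_ + _); apply: eq_bigr => j jC.
  congr (_ * _); rewrite /weight jC mulrDl mul1r; congr (_ + _).
  rewrite mulr_suml; apply: eq_bigr => i iC.
  case: (relay01 iC jC) => [->|xij]; first by rewrite !mul0r.
  by rewrite (fs i j).
case: (ap01 j k) => [->|xjk]; first by rewrite !mul0r.
by rewrite (weight_direct jC xjk) mul1r.
Qed.

Lemma ap_load_gt0 i k : uses i k -> 0 < ap_load Cp x k.
Proof.
move=> uik; rewrite ap_loadE lt_neqAle served_ge0 ?andbT //.
apply/eqP => s0.
have : (1 : R) = 0 by apply: (@served_le0_eq0 k (fun=> 1) _ _ i); rewrite -?s0.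
by move/eqP; rewrite oner_eq0.
Qed.

Lemma fair_ge0 i k : 0 <= fair i k.
Proof.
by rewrite divr_ge0 ?(ltW (weight_gt0 _)) // ap_loadE served_ge0.
Qed.

Lemma fair_gt0 i k : uses i k -> 0 < fair i k.
Proof. by move=> uik; rewrite divr_gt0 ?weight_gt0 ?(ap_load_gt0 uik). Qed.

Lemma fair_share i j k : i \notin Cp -> j \in Cp -> x i (inl j) = 1 ->
  fair i k = fair j k.
Proof.
move=> iC jC xij.
by rewrite /fair (weight_relayed iC jC xij) (weight_relay iC jC xij).
Qed.

Lemma fair_budget k : \sum_i x i (inr k) * fair i k <= 1.
Proof.
have -> : \sum_i x i (inr k) * fair i k = ap_load Cp x k / ap_load Cp x k.
  rewrite {1}ap_loadE served_share // mulr_suml.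
  by apply: eq_bigr => i _; rewrite /fair mulr1 mulrA.
(* At an AP with load 0 the quotient is [0 / 0 = 0], so the budget holds there too. *)
have [->|n0] := eqVneq (ap_load Cp x k) 0; first by rewrite mul0r.
by rewrite divff.
Qed.

(* Pricing AP [k]'s budget at its load: the dual certificate behind optimality of
   [fair]. *)
Lemma served_ratio_fair y k :
  (forall i j, i \notin Cp -> j \in Cp -> x i (inl j) = 1 -> y i k = y j k) ->
  served k (fun i => y i k / fair i k)
  = ap_load Cp x k * \sum_i x i (inr k) * y i k.
Proof.
move=> ys; rewrite served_share => [|i j iC jC xij]; last first.
  by rewrite (ys _ _ iC jC xij) (fair_share _ iC jC xij).
rewrite mulr_sumr; apply: eq_bigr => i _; rewrite /fair invf_div.
by field; rewrite lt0r_neq0 // weight_gt0.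
Qed.

(** The rates cancel, and by [served_ratio_fair] the linear terms [y / fair - 1] cancel against the
    priced budget slack, leaving only logarithms of ratios. Both summands on the right will be
    nonnegative. *)
Lemma objective_fair (r : C -> R) (y : C -> A -> R) :
  (forall i k, uses i k -> 0 < r i) -> (forall i k, uses i k -> 0 < y i k) ->
  (forall i j k, i \notin Cp -> j \in Cp -> x i (inl j) = 1 -> y i k = y j k) ->
  objective Cp x r fair - objective Cp x r y =
  \sum_k (served k (fun i => y i k / fair i k - 1 - ln (y i k / fair i k))
          + ap_load Cp x k * (1 - \sum_i x i (inr k) * y i k)).
Proof.
move=> r0 y0 ys; rewrite !objectiveE -sumrB; apply: eq_bigr => k _.
rewrite mulrBr mulr1 -served_ratio_fair => [|i j]; last exact: ys.
rewrite ap_loadE -[X in _ = _ + X]opprB -!servedB; apply: eq_served => i uik.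
have ri := r0 _ _ uik; have yi := y0 _ _ uik; have fi := fair_gt0 uik.
by rewrite (ln_div yi fi) (lnM ri fi) (lnM ri yi); ring.
Qed.

(** * Rates under linear capacity bounds *)

Variable t : C -> C + A -> R.

(** Here and in [best_client] the sums act as selectors: the single nonzero indicator picks the link
    in use, so no AP or relay has to be chosen. *)
Definition relay_cap (j : C) : R := \sum_(k : A) x j (inr k) * t j (inr k).

Definition best_client (i : C) : R :=
  \sum_(k : A) x i (inr k) * t i (inr k)
  + \sum_(j in Cp) x i (inl j) * Num.min (t i (inl j)) (relay_cap j / 2).

(* A relay and its client share the capacity of the relay's link equally, unless
   the link between them is the bottleneck. *)
Definition best_rate (i : C) : R :=
  if i \in Cp then
    relay_cap i - \sum_(i' | i' \notin Cp) x i' (inl i) * best_client i'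
  else best_client i.

Lemma relay_capE j k : j \in Cp -> x j (inr k) = 1 -> relay_cap j = t j (inr k).
Proof. by move=> jC xjk; rewrite /relay_cap (relay_ap_pick _ jC xjk). Qed.

Lemma best_rate_direct i k : i \notin Cp -> x i (inr k) = 1 ->
  best_rate i = t i (inr k).
Proof.
move=> iC xik; rewrite /best_rate (negbTE iC) /best_client.
rewrite (client_ap_pick _ iC xik) big1 ?addr0 // => j jC.
by rewrite (direct_no_relay iC xik jC) mul0r.
Qed.

Lemma best_rate_relayed i j : i \notin Cp -> j \in Cp -> x i (inl j) = 1 ->
  best_rate i = Num.min (t i (inl j)) (relay_cap j / 2).
Proof.
move=> iC jC xij; rewrite /best_rate (negbTE iC) /best_client.
rewrite (client_relay_pick _ iC jC xij) big1 ?add0r // => k _.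
by rewrite (relayed_no_ap k iC jC xij) mul0r.
Qed.

Lemma best_rate_relay j : j \in Cp ->
  best_rate j
  = relay_cap j - \sum_(i | i \notin Cp) x i (inl j) * best_rate i.
Proof.
move=> jC; rewrite {1}/best_rate jC; congr (_ - _); apply: eq_bigr => i iC.
by rewrite /best_rate (negbTE iC).
Qed.

(** One admissible pair of positive rates forces both capacities to be positive, hence also the
    optimal rates; the relay keeps at least half of its capacity. *)
Lemma relayed_rates_le i j a b : i \notin Cp -> j \in Cp -> x i (inl j) = 1 ->
  0 < a -> 0 < b -> a <= t i (inl j) -> a + b <= relay_cap j ->
  [/\ 0 < best_rate i, 0 < best_rate j, best_rate i <= t i (inl j)
    & ln a + ln b <= ln (best_rate i) + ln (best_rate j)].
Proof.
move=> iC jC xij a0 b0 at_ abT.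
rewrite (best_rate_relay jC) (relay_client_pick _ iC jC xij).
rewrite (best_rate_relayed iC jC xij).
have mT : Num.min (t i (inl j)) (relay_cap j / 2) <= relay_cap j / 2.
  by rewrite ge_min lexx orbT.
split; last exact: ln_two_hop_le.
- by rewrite lt_min; apply/andP; split; lra.
- lra.
- by rewrite ge_min lexx.
Qed.

Section Rates.
Variable r : C -> R.
Hypothesis r_gt0 : forall i k, uses i k -> 0 < r i.
Hypothesis r_client_relay : forall i j, i \notin Cp -> j \in Cp ->
  r i * x i (inl j) <= t i (inl j).
Hypothesis r_client_ap : forall i k, i \notin Cp ->
  r i * x i (inr k) <= t i (inr k).
Hypothesis r_relay_ap : forall j k, j \in Cp ->
  ((\sum_(i | i \notin Cp) r i * x i (inl j)) + r j) * x j (inr k)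
  <= t j (inr k).

Lemma relay_rate_le j k : j \in Cp -> x j (inr k) = 1 ->
  (\sum_(i | i \notin Cp) x i (inl j) * r i) + r j <= relay_cap j.
Proof.
move=> jC xjk; rewrite (relay_capE jC xjk).
have := r_relay_ap k jC; rewrite xjk mulr1.
by under eq_bigr do rewrite mulrC.
Qed.

Lemma relayed_best i j k : i \notin Cp -> j \in Cp -> x i (inl j) = 1 ->
  x j (inr k) = 1 ->
  [/\ 0 < best_rate i, 0 < best_rate j, best_rate i <= t i (inl j)
    & ln (r i) + ln (r j) <= ln (best_rate i) + ln (best_rate j)].
Proof.
move=> iC jC xij xjk; apply: relayed_rates_le => //.
- by apply: (r_gt0 (k := k)); right; exists j.
- by apply: (r_gt0 (k := k)); left.
- by have := r_client_relay iC jC; rewrite xij mulr1.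
- by have := relay_rate_le jC xjk; rewrite (relay_client_pick _ iC jC xij).
Qed.

Lemma idle_best j k : j \in Cp -> (forall i, i \notin Cp -> x i (inl j) = 0) ->
  x j (inr k) = 1 -> r j <= best_rate j.
Proof.
move=> jC idle xjk; rewrite best_rate_relay //.
have := relay_rate_le jC xjk.
rewrite !big1 ?add0r ?subr0 // => i iC; by rewrite idle // mul0r.
Qed.

Lemma direct_best i k : i \notin Cp -> x i (inr k) = 1 -> r i <= best_rate i.
Proof.
move=> iC xik; rewrite (best_rate_direct iC xik).
by have := r_client_ap k iC; rewrite xik mulr1.
Qed.

Lemma best_rate_gt0 i k : uses i k -> 0 < best_rate i.
Proof.
move=> [xik|[j [iC jC xij xjk]]]; last by case: (relayed_best iC jC xij xjk).
have ri : 0 < r i by apply: (r_gt0 (k := k)); left.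
have [iC|iC] := boolP (i \in Cp); last exact: lt_le_trans (direct_best iC xik).
case: (relayP iC) => [idle|i' iC' xi'i].
  exact: lt_le_trans (idle_best iC idle xik).
by case: (relayed_best iC' iC xi'i xik).
Qed.

Lemma best_rate_relay_le i j : i \notin Cp -> j \in Cp ->
  best_rate i * x i (inl j) <= t i (inl j).
Proof.
move=> iC jC; case: (relay01 iC jC) => xij; rewrite xij.
  (* On an inactive link the bound reads [0 <= t], whatever the rate, and is inherited from [r]. *)
  by have := r_client_relay iC jC; rewrite xij !mulr0.
by rewrite mulr1 (best_rate_relayed iC jC xij) ge_min lexx.
Qed.

Lemma best_rate_client_ap_le i k : i \notin Cp ->
  best_rate i * x i (inr k) <= t i (inr k).
Proof.
move=> iC; case: (ap01 i k) => xik; rewrite xik.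
  by have := r_client_ap k iC; rewrite xik !mulr0.
by rewrite mulr1 (best_rate_direct iC xik).
Qed.

Lemma best_rate_relay_ap_le j k : j \in Cp ->
  ((\sum_(i | i \notin Cp) best_rate i * x i (inl j)) + best_rate j)
  * x j (inr k) <= t j (inr k).
Proof.
move=> jC; case: (ap01 j k) => xjk; rewrite xjk.
  by have := r_relay_ap k jC; rewrite xjk !mulr0.
rewrite mulr1 best_rate_relay // (relay_capE jC xjk).
under eq_bigr do rewrite mulrC.
by rewrite addrC subrK.
Qed.

(** The fractions cancel. Direct clients and idle relays are compared one by one; a busy relay and
    its client only jointly, since one of the two may lose rate. *)
Lemma objective_best_rate (y : C -> A -> R) : (forall i k, uses i k -> 0 < y i k) ->
  objective Cp x r y <= objective Cp x best_rate y.
Proof.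
move=> y0; rewrite -subr_ge0 !objectiveE -sumrB; apply: sumr_ge0 => k _.
rewrite -servedB.
rewrite (@eq_served k _ (fun i => ln (best_rate i) - ln (r i))); last first.
  move=> i uik; have bi := best_rate_gt0 uik; have ri := r_gt0 uik.
  by rewrite !lnM ?posrE ?(y0 _ _ uik) //; ring.
rewrite served_by_transmitter; apply: addr_ge0.
  apply: sumr_ge0 => i iC.
  case: (ap01 i k) => xik; rewrite xik ?mul0r // mul1r subr_ge0.
  have ri : 0 < r i by apply: (r_gt0 (k := k)); left.
  have rb := direct_best iC xik.
  by rewrite ler_ln ?posrE // (lt_le_trans ri).
apply: sumr_ge0 => j jC.
case: (ap01 j k) => xjk; rewrite xjk ?mul0r // mul1r.
case: (relayP jC) => [idle|i iC xij].
  rewrite big1 => [|i iC]; last by rewrite idle // mul0r.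
  have rj : 0 < r j by apply: (r_gt0 (k := k)); left.
  have rb := idle_best jC idle xjk.
  by rewrite addr0 subr_ge0 ler_ln ?posrE // (lt_le_trans rj).
rewrite (relay_client_pick _ iC jC xij).
by have [_ _ _ le_ln] := relayed_best iC jC xij xjk; lra.
Qed.

End Rates.

End Association.

(** * Feasibility and optimality in problem (P) *)

Section Feasibility.
Variables (R : realType) (A C : finType) (Cp : {set C}).
Variables (law : C -> C + A -> R.-pker R ~> R) (s : C -> C + A -> R).
Variables (eta : R) (x : C -> C + A -> R).

(** Definedness of the objective gives only a positive product; nonnegativity of the fraction then
    fixes the sign of each factor. *)
Lemma feasible_gt0 r y : feasible Cp law s eta x r y ->
  forall i k, uses Cp x i k -> 0 < r i /\ 0 < y i k.
Proof.
move=> [cs [d1 d2]] i k uik.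
have ry : 0 < r i * y i k.
  case: uik => [xik|[j [iC jC xij xjk]]]; first by apply: d1; rewrite xik oner_eq0.
  by apply: (d2 _ j) => //; rewrite xij xjk mulr1 oner_eq0.
have y0 : 0 < y i k.
  rewrite lt_neqAle (fraction_ge0 cs) andbT; apply/eqP => y0.
  by move: ry; rewrite -y0 mulr0 ltxx.
by split=> //; move: ry; rewrite pmulr_lgt0.
Qed.

Lemma defined_uses (r : C -> R) (y : C -> A -> R) :
  (forall i b, is_link Cp i b -> x i b = 0 \/ x i b = 1) ->
  (forall i k, uses Cp x i k -> 0 < r i) ->
  (forall i k, uses Cp x i k -> 0 < y i k) -> objective_defined Cp x r y.
Proof.
move=> x01 r0 y0.
have ry i k : uses Cp x i k -> 0 < r i * y i k.
  by move=> uik; rewrite mulr_gt0 ?(r0 _ _ uik) ?(y0 _ _ uik).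
split=> [i k|i j k iC jC] nz; apply: ry.
  by left; case: (x01 i (inr k)) => // xik; rewrite xik eqxx in nz.
right; exists j; split=> //.
  by case: (x01 i (inl j)); rewrite /= ?iC // => xij; rewrite xij mul0r eqxx in nz.
by case: (x01 j (inr k)) => // xjk; rewrite xjk mulr0 eqxx in nz.
Qed.

Lemma feasible_fair r y : feasible Cp law s eta x r y ->
  feasible Cp law s eta x r (fair Cp x).
Proof.
move=> ry; have [cs _] := ry; have ry0 := feasible_gt0 ry.
case: cs => ? ? ? client1 load1 relay1 ? x01 ? ?; split.
  split=> // [i j k iC jC|k|i k].
  - have x01ij : x i (inl j) = 0 \/ x i (inl j) = 1 by apply: x01; rewrite /= iC.
    case: x01ij => [->|xij]; first by rewrite mulr0.
    by rewrite (fair_share x01 client1 load1 k iC jC xij) subrr mul0r.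
  - exact: fair_budget.
  - exact: fair_ge0.
apply: defined_uses => // i k uik; first by case: (ry0 i k uik).
exact: fair_gt0.
Qed.

(** The gap is a sum over APs of nonnegative terms. If it is not positive, each logarithmic gap
    vanishes, so each ratio of [y] to [fair] in use is 1. *)
Lemma objective_fair_ge r y : feasible Cp law s eta x r y ->
  objective Cp x r y <= objective Cp x r (fair Cp x) /\
  (objective Cp x r (fair Cp x) <= objective Cp x r y ->
   forall i k, uses Cp x i k -> y i k = fair Cp x i k).
Proof.
move=> ry; have [cs _] := ry; have ry0 := feasible_gt0 ry.
case: cs => ? ? ? client1 load1 relay1 share x01 budget ?.
have f0 i k : uses Cp x i k -> 0 < fair Cp x i k by exact: fair_gt0.
have q0 i k : uses Cp x i k -> 0 < y i k / fair Cp x i k.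
  by move=> uik; case: (ry0 _ _ uik) => _ yi; rewrite divr_gt0 ?f0.
have g0 k : 0 <= served Cp x k
    (fun i => y i k / fair Cp x i k - 1 - ln (y i k / fair Cp x i k)).
  by apply: served_ge0 => // i /q0; exact: ln_gap_ge0.
have b0 k : 0 <= ap_load Cp x k * (1 - \sum_i x i (inr k) * y i k).
  by rewrite mulr_ge0 ?subr_ge0 ?budget // ap_loadE served_ge0.
have gap : objective Cp x r (fair Cp x) - objective Cp x r y =
  \sum_k (served Cp x k
             (fun i => y i k / fair Cp x i k - 1 - ln (y i k / fair Cp x i k))
          + ap_load Cp x k * (1 - \sum_i x i (inr k) * y i k)).
  apply: objective_fair => // [i k /ry0[]//|i k /ry0[]//|i j k iC jC xij].
  by apply/eqP; rewrite -subr_eq0 -[_ - _]mulr1 -xij share.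
split=> [|opt i k uik]; first by rewrite -subr_ge0 gap sumr_ge0 // => k _; rewrite addr_ge0.
have gk := @psumr_le0_eq0 R A predT _ (fun k _ => addr_ge0 (g0 k) (b0 k)) _ k erefl.
rewrite /= -gap subr_le0 in gk.
have gk0 := served_le0_eq0 x01 (k := k) _ _ uik.
have /= ln0 := gk0 _ (fun i uik => ln_gap_ge0 (q0 i k uik)) _.
have q1 : y i k / fair Cp x i k = 1.
  apply: ln_gap_eq0; first exact: q0.
  by apply: ln0; have := b0 k; have := gk opt; lra.
by rewrite -[RHS]mul1r -q1 divfK // gt_eqF // f0.
Qed.

Variable t : C -> C + A -> R.
Hypothesis outage : forall i b, is_link Cp i b -> forall z : R,
  (condPr law s i b [set c | z >= c]%R <= eta%:E)%E <-> z <= t i b.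

Lemma feasible_best_rate r y : feasible Cp law s eta x r y ->
  feasible Cp law s eta x (best_rate Cp x t) y /\
  objective Cp x r y <= objective Cp x (best_rate Cp x t) y.
Proof.
move=> ry; have [cs _] := ry; have ry0 := feasible_gt0 ry.
case: cs => out_cr out_ca out_ra client1 load1 relay1 ? x01 ? ?.
have r0 i k : uses Cp x i k -> 0 < r i by case/ry0.
have y0 i k : uses Cp x i k -> 0 < y i k by case/ry0.
have link i j : i \notin Cp -> j \in Cp -> is_link Cp i (inl j : C + A).
  by move=> iC jC; rewrite /= iC.
have r_cr i j : i \notin Cp -> j \in Cp -> r i * x i (inl j) <= t i (inl j).
  by move=> iC jC; apply/outage; [exact: link|exact: out_cr].
have r_ca i k : i \notin Cp -> r i * x i (inr k) <= t i (inr k).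
  by move=> iC; apply/outage => //; exact: out_ca.
have r_ra j k : j \in Cp ->
    ((\sum_(i | i \notin Cp) r i * x i (inl j)) + r j) * x j (inr k)
    <= t j (inr k).
  by move=> jC; apply/outage => //; exact: out_ra.
split; last exact: objective_best_rate.
split; last by apply: defined_uses => // i k; exact: (best_rate_gt0 x01 client1 load1 relay1 r0).
split=> // [i j iC jC|i k iC|j k jC]; apply/outage => //.
- exact: link.
- exact: (best_rate_relay_le x01 client1 r_cr).
- exact: (best_rate_client_ap_le x01 client1 r_ca).
- exact: (best_rate_relay_ap_le x01 relay1 r_ra).
Qed.

End Feasibility.

Theorem mainTheorem2 (d : measure_display) (T : measurableType d)
    (R : realType) (P : probability T R)
    (A C : finType) (Cp : {set C})
    (SNR SNRest : C -> C + A -> {RV P >-> R})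
    (law : C -> C + A -> R.-pker R ~> R) (s : C -> C + A -> R)
    (eta : R) (x : C -> C + A -> R)
    (law_rate : forall i b, is_link Cp i b ->
       is_cond_distribution (SNRest i b) (rate (SNR i b)) (law i b))
    (eta_gt0 : 0 < eta) (eta_lt1 : eta < 1)
    (threshold : forall i b, is_link Cp i b ->
       exists! t : R, condPr law s i b [set c | c <= t] = eta%:E)
    (x_feasible : exists r y, feasible Cp law s eta x r y) :
  (exists r y, optimal Cp law s eta x r y) /\
  (forall r y, optimal Cp law s eta x r y ->
    [/\ forall i k, i \notin Cp -> x i (inr k) = 1 ->
          y i k = 1 / ap_load Cp x k,
        forall j k, j \in Cp ->
          \sum_(i | i \notin Cp) x i (inl j) = 0 -> x j (inr k) = 1 ->
          y j k = 1 / ap_load Cp x k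
      & forall i j k, i \notin Cp -> j \in Cp ->
          x i (inl j) * x j (inr k) = 1 ->
          y i k = 2 / ap_load Cp x k /\ y j k = 2 / ap_load Cp x k]).
Proof.
have [t outage] : exists t : C -> C + A -> R, forall i b, is_link Cp i b ->
    forall z : R, (condPr law s i b [set c | z >= c]%R <= eta%:E)%E <-> z <= t i b.
  (* Thresholds are chosen for all pairs at once, with the arbitrary value 0 off the links. *)
  have /choice[t ht] (p : C * (C + A)) : exists t : R, is_link Cp p.1 p.2 ->
      forall z : R,
        (condPr law s p.1 p.2 [set c | z >= c]%R <= eta%:E)%E <-> z <= t.
    have [/threshold/outage_threshold[u hu]|_] := boolP (is_link Cp p.1 p.2).
      by exists u.
    by exists 0.
  by exists (fun i b => t (i, b)) => i b; exact: (ht (i, b)).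
split.
  (* Replacing first the fractions and then the rates takes any feasible pair to the same pair,
     preserving feasibility and never lowering the objective. *)
  have [r [y /feasible_fair/(feasible_best_rate outage)[opt _]]] := x_feasible.
  exists (best_rate Cp x t), (fair Cp x); split=> // r' y' ry'.
  apply: le_trans (feasible_best_rate outage (feasible_fair ry')).2.
  exact: (objective_fair_ge ry').1.
move=> r y [ry opt].
(* Optimality is tested against the fair fractions with the same rates [r], which puts [y] in the
   equality case. *)
have y_fair := (objective_fair_ge ry).2 (opt _ _ (feasible_fair ry)).
case: ry.1 => _ _ _ client1 load1 relay1 share x01 _ _.
split=> [i k iC xik|j k jC idle xjk|i j k iC jC xx].
- by rewrite y_fair; [rewrite /fair (weight_direct x01 client1 iC xik)|left].
- by rewrite y_fair; [rewrite /fair /weight jC idle addr0|left].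
have [xij xjk] : x i (inl j) = 1 /\ x j (inr k) = 1.
  have xij : x i (inl j) = 1.
    case: (x01 i (inl j)) => [|xij|//]; first by rewrite /= iC.
    by move: xx; rewrite xij mul0r => /eqP; rewrite eq_sym oner_eq0.
  by split=> //; move: xx; rewrite xij mul1r.
rewrite !y_fair; [|by left|by right; exists j].
by rewrite /fair (weight_relayed x01 client1 iC jC xij) (weight_relay x01 load1 iC jC xij).
Qed.
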